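(* For any $K_4$-minor-free multigraph $G$ of maximum degree $\Delta$, the strong chromatic index of $G$ satisfies $\chi_2'(G)\le 3\Delta$.
   Context: Multigraphs may have parallel edges; the degree of a vertex counts edges with multiplicity. A multigraph is $K_k$-minor-free if its underlying simple graph has no $K_k$ minor. A strong edge-colouring of a multigraph $G$ is a partition of its edge set into parts each of which is an induced matching of $G$ (no two edges of a part are incident, i.e. share an endpoint — parallel edges are incident — and no two are joined by an edge of $G$). The strong chromatic index $\chi_2'(G)$ is the minimum number of parts of such a partition. *)

(* Defs.v *)
From mathcomp Require Import all_boot.

Set Implicit Arguments.
Unset Strict Implicit.
Unset Printing Implicit Defensive.

(* Finite loopless multigraphs: distinct elements of [edge] with the same set
   of endpoints are parallel edges. *)
Record multigraph := Multigraph {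
  vertex : finType;
  edge : finType;
  ends : edge -> {set vertex};
  card_ends : forall e : edge, #|ends e| = 2
}.

Definition degree (G : multigraph) (v : vertex G) : nat :=
  #|[set e : edge G | v \in ends e]|.

Definition max_degree (G : multigraph) : nat :=
  \max_(v : vertex G) degree v.

(* Adjacency of the underlying simple graph; irreflexive since [set u; u] has
   only one element. *)
Definition adj (G : multigraph) : rel (vertex G) :=
  fun u v => [exists e : edge G, ends e == [set u; v]].

Lemma adj_sym (G : multigraph) : symmetric (@adj G).
Proof. by move=> u v; apply: eq_existsb => e; rewrite setUC. Qed.

Lemma adj_irrefl (G : multigraph) : irreflexive (@adj G).
Proof.
move=> u; apply/existsP => -[e /eqP eu].
by have := card_ends e; rewrite eu setUid cards1.
Qed.

Definition connected_set (T : finType) (g : rel T) (A : {set T}) : Prop :=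
  {in A &, forall u v : T,
     connect [rel x y | [&& x \in A, y \in A & g x y]] u v}.

(* The simple graph [h] on [S] is a minor of the simple graph [g] on [T];
   [B x] is the branch set contracted to the vertex [x] of [h]. *)
Definition has_minor (S T : finType) (h : rel S) (g : rel T) : Prop :=
  exists B : S -> {set T},
    [/\ forall x : S, B x != set0 /\ connected_set g (B x),
        forall x y : S, x != y -> [disjoint B x & B y]
      & forall x y : S, h x y ->
          exists u v : T, [/\ u \in B x, v \in B y & g u v]].

Definition complete_graph (k : nat) : rel 'I_k := fun i j => i != j.

Definition complete_minor_free (k : nat) (G : multigraph) : Prop :=
  ~ has_minor (@complete_graph k) (@adj G).

Section StrongEdgeColouring.
Variable G : multigraph.

Definition incident_edges (e f : edge G) : bool :=
  ~~ [disjoint ends e & ends f].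

Definition joined_edges (e f : edge G) : bool :=
  [exists u in ends e, exists v in ends f, adj u v].

Definition induced_matching (M : {set edge G}) : bool :=
  [forall e in M, forall f in M,
     (e != f) ==> ~~ incident_edges e f && ~~ joined_edges e f].

Definition strong_edge_colouring (P : {set {set edge G}}) : bool :=
  partition P [set: edge G] && [forall M in P, induced_matching M].

Definition strong_edge_colourable (n : nat) : bool :=
  [exists P : {set {set edge G}}, strong_edge_colouring P && (#|P| == n)].

Lemma strong_edge_colourable_ex : exists n : nat, strong_edge_colourable n.
Proof.
pose P := [set [set e] | e : edge G].
exists #|P|; apply/existsP; exists P; rewrite eqxx andbT.
apply/andP; split; last first.
  apply/forall_inP => M /imsetP[e _ ->]; apply/forall_inP => f /set1P->.
  by apply/forall_inP => g /set1P->; rewrite eqxx.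
apply/and3P; split.
- rewrite eqEsubset subsetT; apply/subsetP => e _.
  by apply/bigcupP; exists [set e]; [apply: imset_f | apply: set11].
- apply/trivIsetP => _ _ /imsetP[e _ ->] /imsetP[f _ ->] ef.
  by rewrite disjoints1 in_set1; apply: contraNneq ef => ->.
- by apply/imsetP => -[e _ /setP/(_ e)]; rewrite in_set0 set11.
Qed.

Definition strong_chromatic_index : nat := ex_minn strong_edge_colourable_ex.

End StrongEdgeColouring.

(* Main.v *)
(* A K4-minor-free graph has a vertex with at most two neighbours (Dirac);
   eliminating it, that is, contracting it into one of its neighbours, and
   iterating yields a chordal supergraph h together with an ordering of the
   vertices in which the earlier h-neighbours of every vertex form a clique of
   size at most 2.  Colour the edges greedily by increasing lower endpoint.  If
   e has lower endpoint u, then the clique property forces every previously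
   coloured edge that is joined to e, even by an edge of h, to meet u or one of
   its at most two earlier h-neighbours.  At most 3 Delta edges, one of which is
   e itself, do so, hence 3 Delta colours suffice. *)
Require Import Defs.
From mathcomp Require Import all_boot.

Set Implicit Arguments.
Unset Strict Implicit.
Unset Printing Implicit Defensive.

(** * Minors inside a vertex set, and contraction of edges *)

Section Minors.
Variable T : finType.
Implicit Types (g : rel T) (A B C D : {set T}) (x y z v w r : T).

(* Connectedness in terms of cuts, so that no path has to be rerouted when an
   edge is contracted. *)
Definition conn g B : Prop :=
  forall D, D \proper B -> D != set0 ->
  exists a b, [/\ a \in D, b \in B :\: D & g a b].

Definition touch g B C : Prop := exists a b, [/\ a \in B, b \in C & g a b].

(** Confining the branch sets to [A] lets vertices be deleted by shrinking [A] while the type [T]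
    stays fixed. *)
Definition K4_minor g A : Prop :=
  exists B : 'I_4 -> {set T},
    (forall i, [/\ B i \subset A, B i != set0 & conn g (B i)])
    /\ forall i j, i != j -> [disjoint B i & B j] /\ touch g (B i) (B j).

(** The edge [x y] is contracted onto [x]; [y] disappears only on passing to [A :\ y]. The conjunct
    [a != b] discards the loop created at [x]. *)
Definition contr g x y : rel T := fun a b =>
  (a != b) && [|| g a b, (a == x) && g y b | (b == x) && g a y].

Definition nbrs g A v : {set T} := [set w in A | g v w].

Lemma contr_sym g x y : symmetric g -> symmetric (contr g x y).
Proof.
move=> gs a b; rewrite /contr eq_sym gs (gs y b) (gs a y).
by congr (_ && (_ || _)); rewrite orbC.
Qed.

Lemma contr_irrefl g x y : irreflexive (contr g x y).
Proof. by move=> a; rewrite /contr eqxx. Qed.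

Lemma conn1 g x : conn g [set x].
Proof. by move=> D; rewrite properE subset1 => /andP[/orP[]/eqP-> //]; rewrite ?subxx ?eqxx. Qed.

Lemma touch_sym g B C : symmetric g -> touch g B C -> touch g C B.
Proof. by move=> gs [a [b [aB bC gab]]]; exists b, a; split; rewrite // gs. Qed.

Lemma connU1 g B x y : symmetric g -> conn g B -> x \in B -> g x y ->
  conn g (y |: B).
Proof.
move=> gs cB xB gxy D /properP[sD [c cyB cD]] D0.
have [yB|yB] := boolP (y \in B).
  have eB : y |: B = B by apply/setUidPr; rewrite sub1set.
  by move: sD cyB; rewrite eB => sD cB'; apply: cB => //; apply/properP; split=> //; exists c.
have [DB|] := boolP (B \subset D).
  exists x, y; split=> //; first exact: (subsetP DB).
  rewrite !inE eqxx andbT; apply: contra cD => yD.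
  by case/setU1P: cyB => [->//|/(subsetP DB)].
move=> nBD; have [DB|] := boolP (D :&: B == set0).
  have yD : y \in D.
    case/set0Pn: D0 => d dD; have /setU1P[<- //|dB] := subsetP sD _ dD.
    by move/eqP/setP/(_ d): DB; rewrite !inE dD dB.
  exists y, x; split=> //; last by rewrite gs.
  rewrite !inE xB orbT andbT; apply/negP => xD.
  by move/eqP/setP/(_ x): DB; rewrite !inE xD xB.
move=> DB; have [|a [b [aD bD gab]]] := cB (D :&: B) _ DB.
  by rewrite properE subsetIr subsetI subxx andbT.
exists a, b; split=> //; first by case/setIP: aD.
by move: bD; rewrite !inE => /andP[nb bB]; move: nb; rewrite bB !andbT orbT andbT.
Qed.

Lemma K4_minor_sub g h A C : A \subset C ->
  {in A &, subrel g h} -> K4_minor g A -> K4_minor h C.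
Proof.
move=> AC gh [B [B1 B2]]; exists B; split=> [i|i j ij].
  have [BA B0 cB] := B1 i; split=> //; first exact: subset_trans AC.
  move=> D DB D0; have [a [b [aD bD gab]]] := cB D DB D0; exists a, b; split=> //.
  apply: gh => //; apply: (subsetP BA); last by case/setDP: bD.
  by apply: (subsetP (proper_sub DB)).
have [dB [a [b [aB bB gab]]]] := B2 i j ij; split=> //; exists a, b; split=> //.
have [[BA _ _] [BA' _ _]] := (B1 i, B1 j).
by apply: gh => //; [apply: (subsetP BA) | apply: (subsetP BA')].
Qed.

(** By symmetry a cut may be exchanged for its complement, so let [x] lie outside [D]. If [y] is in
    [D], the edge [x y] crosses; otherwise [D] cuts [B], and a crossing edge created by the
    contraction ends in [x] and comes from one ending in [y]. *)
Lemma conn_contr_in g x y B : symmetric g -> g x y -> x \in B -> y \notin B ->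
  conn (contr g x y) B -> conn g (y |: B).
Proof.
move=> gs gxy xB yB cB.
suff side D : x \notin D -> D \proper y |: B -> D != set0 ->
    exists a b, [/\ a \in D, b \in (y |: B) :\: D & g a b].
  move=> D DB D0; have [xD|xD] := boolP (x \in D); last exact: side.
  have [||| b [a [bD aD gab]]] := side ((y |: B) :\: D).
  - by rewrite !inE xD.
  - rewrite properE subsetDl; apply/subsetPn; exists x; rewrite !inE ?xB ?xD ?orbT //.
  - by rewrite -subset0 subDset setU0; case/andP: DB.
  exists a, b; split; rewrite 1?gs //.
  by move: aD; rewrite !inE; case: (a \in D) => //=; case: (_ || _).
move=> xD DB D0; have [yD|yD] := boolP (y \in D).
  by exists y, x; split; rewrite ?inE ?xB ?xD ?orbT // gs.
have DB' : D \proper B.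
  rewrite properE; apply/andP; split; last by apply/subsetPn; exists x.
  apply/subsetP => d dD; have /setU1P[dy|//] := subsetP (proper_sub DB) _ dD.
  by rewrite -dy dD in yD.
have [a [b [aD bD /andP[_ /or3P[gab|/andP[/eqP ax _]|/andP[_ gay]]]]]] := cB D DB' D0.
- by exists a, b; split=> //; move: bD; rewrite !inE => /andP[-> ->]; rewrite orbT.
- by rewrite -ax aD in xD.
- by exists a, y; split; rewrite ?inE ?eqxx ?yD.
Qed.

Lemma conn_contr_notin g x y B : x \notin B -> conn (contr g x y) B -> conn g B.
Proof.
move=> xB cB D DB D0; have [a [b [aD bD]]] := cB D DB D0.
have aB := subsetP (proper_sub DB) _ aD; have /setDP[bB _] := bD.
case/andP=> _ /or3P[gab|/andP[/eqP ax _]|/andP[/eqP bx _]]; first by exists a, b.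
  by rewrite -ax aB in xB.
by rewrite -bx bB in xB.
Qed.

(** The vertex [y] rejoins the branch set containing [x], if there is one. An edge of the
    contraction absent from [g] has an endpoint [x] that can be replaced by [y]. *)
Lemma K4_contr g A x y : symmetric g -> y \in A -> g x y ->
  K4_minor (contr g x y) (A :\ y) -> K4_minor g A.
Proof.
move=> gs yA gxy [B [B1 B2]].
pose B' i := if x \in B i then y |: B i else B i.
have yB i : y \notin B i.
  by have [/subsetP s _ _] := B1 i; apply/negP => /s; rewrite !inE eqxx.
have sB i : B i \subset B' i by rewrite /B'; case: ifP => // _; apply: subsetUr.
exists B'; split=> [i|i j ij].
  have [BA B0 cB] := B1 i; split.
  - rewrite /B'; case: ifP => _; last exact: subset_trans BA (subsetDl _ _).
    by rewrite subUset sub1set yA (subset_trans BA) ?subsetDl.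
  - by case/set0Pn: B0 => b /(subsetP (sB i)) bB; apply/set0Pn; exists b.
  - rewrite /B'; case: ifP => [xB|/negbT xB]; first exact: (conn_contr_in gs gxy xB (yB i) cB).
    exact: conn_contr_notin cB.
have dU b (C D : {set T}) : [disjoint b |: C & D] = (b \notin D) && [disjoint C & D].
  by rewrite -!setI_eq0 setIUl setU_eq0 !setI_eq0 disjoints1.
have [dB tB] := B2 i j ij; split.
  rewrite /B'; case: ifP => xi; case: ifP => xj.
  - by rewrite (disjointFr dB xi) in xj.
  - by rewrite dU yB.
  - by rewrite disjoint_sym dU yB disjoint_sym.
  - by [].
case: tB => a [b [aB bB /andP[ab]]].
case/or3P => [gab|/andP[/eqP ax gyb]|/andP[/eqP bx gay]].
- by exists a, b; split; rewrite ?(subsetP (sB _)).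
- by exists y, b; split=> //; [rewrite /B' -ax aB setU11 | apply: (subsetP (sB j))].
- by exists a, y; split=> //; [apply: (subsetP (sB i)) | rewrite /B' -bx bB setU11].
Qed.

Lemma K4_build g A (B0 B1 B2 B3 : {set T}) : symmetric g ->
  (forall B, B \in [:: B0; B1; B2; B3] ->
     [/\ B \subset A, B != set0 & conn g B]) ->
  pairwise (fun B C : {set T} => [disjoint B & C]) [:: B0; B1; B2; B3] ->
  touch g B0 B1 -> touch g B0 B2 -> touch g B0 B3 ->
  touch g B1 B2 -> touch g B1 B3 -> touch g B2 B3 -> K4_minor g A.
Proof.
move=> gs BA /= /and4P[/and4P[d01 d02 d03 _] /and3P[d12 d13 _] /andP[d23 _] _].
move=> t01 t02 t03 t12 t13 t23.
exists (fun i => nth set0 [:: B0; B1; B2; B3] i); split=> [i|i j].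
  by apply: BA; apply: mem_nth.
wlog ij : i j / i < j => [wlog ne|_].
  have := ne; rewrite neq_ltn => /orP[lt|lt]; first exact: wlog.
  have [|d t] := wlog j i lt; first by rewrite eq_sym.
  by split; [rewrite disjoint_sym | apply: touch_sym].
by case: i j ij => [[|[|[|[|i]]]] hi] [[|[|[|[|j]]]] hj].
Qed.

Lemma component_exists g A w : symmetric g -> w \in A ->
  exists D, [/\ w \in D, D \subset A, conn g D &
    forall a b, a \in D -> b \in A -> g a b -> b \in D].
Proof.
move=> gs wA.
suff grow n D : #|A :\: D| <= n -> w \in D -> D \subset A -> conn g D ->
    exists D, [/\ w \in D, D \subset A, conn g D &
      forall a b, a \in D -> b \in A -> g a b -> b \in D].
  apply: (grow _ [set w] (leqnn _)); rewrite ?set11 ?sub1set //; exact: conn1.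
elim: n D => [|n IHn] D cD wD DA coD.
  exists D; split=> // a b _ bA _; move: cD; rewrite leqn0 cards_eq0 setD_eq0.
  by move/subsetP/(_ b bA).
case: (boolP [exists a in D, [exists b in A :\: D, g a b]]) => [|no].
  case/exists_inP=> a aD /exists_inP[b bD gab].
  have /setDP[bA bnD] := bD.
  apply: (IHn (b |: D)).
  - rewrite -ltnS; apply: leq_trans cD; apply: proper_card; apply/properP.
    split; first by apply: setDS; apply: subsetUr.
    by exists b => //; rewrite !inE eqxx.
  - by rewrite !inE wD orbT.
  - by rewrite subUset sub1set bA.
  - exact: connU1 aD gab.
exists D; split=> // a b aD bA gab; apply: contraR no => bD.
by apply/exists_inP; exists a => //; apply/exists_inP; exists b; rewrite // !inE bA bD.
Qed.

(** * Dirac's theorem: a vertex of degree at most two *)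

(** The contraction can cost [v] only the neighbour [y]. A drop to degree two thus forces exactly
    three neighbours, [y] among them; and [x] was already one, as otherwise gaining it would have
    made up for the loss. *)
Lemma contr_degree_drop g A x y v : symmetric g -> irreflexive g ->
  x \in A -> y \in A -> x != y -> v \in A -> v != x -> v != y ->
  2 < #|nbrs g A v| -> #|nbrs (contr g x y) (A :\ y) v| <= 2 ->
  exists w, nbrs g A v = [set x; y; w] /\ [/\ w != x, w != y, w != v & w \in A].
Proof.
move=> gs gi xA yA xy vA vx vy d3 d2.
have sub : nbrs g A v :\ y \subset nbrs (contr g x y) (A :\ y) v.
  apply/subsetP => b; rewrite !inE /contr => /and3P[-> -> gvb].
  by rewrite gvb /= !andbT; apply: contraTneq gvb => <-; rewrite gi.
have gvy : g v y.
  apply: contraLR d3 => gvy; rewrite -leqNgt (leq_trans _ d2) //.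
  apply: leq_trans (subset_leq_card sub); rewrite subset_leq_card //.
  apply/subsetP => b bN; rewrite in_setD1 bN andbT.
  by apply: contraNneq gvy => <-; move: bN; rewrite inE => /andP[].
have yN : y \in nbrs g A v by rewrite inE yA.
have xN' : x \in nbrs (contr g x y) (A :\ y) v.
  by rewrite !inE /contr xy xA vx eqxx gvy /= !orbT.
have c2 : #|nbrs g A v :\ y| = 2.
  apply/eqP; rewrite eqn_leq (leq_trans (subset_leq_card sub)) //=.
  by move: d3; rewrite (cardsD1 y) yN.
have eqN : nbrs g A v :\ y = nbrs (contr g x y) (A :\ y) v.
  by apply/eqP; rewrite eqEcard sub c2.
have xN : x \in nbrs g A v :\ y by rewrite eqN.
have /cards1P[w ew] : #|(nbrs g A v :\ y) :\ x| == 1.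
  by move/eqP: c2; rewrite (cardsD1 x) xN add1n eqSS.
have := set11 w; rewrite -ew !inE => /and4P[wx wy wA gvw].
exists w; split; last by split=> //; apply: contraTneq gvw => ->; rewrite gi.
by rewrite -(setD1K yN) -(setD1K xN) ew; apply/setP => b; rewrite !inE; do !case: eqP.
Qed.

(* Dirac's theorem with one exceptional vertex [r].  If contracting neither [ry]
   nor a suitable edge [zw] preserves the degree condition, then [z] and [y] are
   adjacent and, unless there is an explicit K4, have no neighbours besides [r]
   and [w].  The component of [w] after deletion of [z], [y] and [r] then either
   touches [r], giving a K4 minor, or satisfies the hypotheses with [w] as its
   exceptional vertex. *)
Lemma rooted_dirac g A r y : symmetric g -> irreflexive g ->
  r \in A -> y \in A -> g r y ->
  {in A :\ r, forall v, 2 < #|nbrs g A v|} -> K4_minor g A.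
Proof.
have [n] := ubnP #|A|; elim: n => // n IHn in g A r y *.
rewrite ltnS => An gs gi rA yA gry d3.
have smaller a : a \in A -> #|A :\ a| < n.
  by move=> aA; apply: leq_trans An; rewrite [leqRHS](cardsD1 a) aA.
have neq a b : g a b -> a != b by apply: contraTneq => ->; rewrite gi.
have ry := neq _ _ gry.
case: (boolP [forall v in A :\ y :\ r, 2 < #|nbrs (contr g r y) (A :\ y) v|]).
  move/forall_inP => d3'; apply: (K4_contr gs yA gry).
  (* The contraction passes [y'] on to [r], giving the root the neighbour that the induction
     hypothesis asks for. *)
  have [y' y'N y'r] : exists2 y', y' \in nbrs g A y & y' != r.
    have /card_gt0P[y'] : 0 < #|nbrs g A y :\ r|.
      have := d3 y; rewrite !inE eq_sym ry yA => /(_ isT).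
      by rewrite (cardsD1 r); case: (r \in _); [rewrite add1n ltnS => /ltnW | move/ltnW/ltnW].
    by rewrite in_setD1 => /andP[? ?]; exists y'.
  move: y'N; rewrite inE => /andP[y'A gyy'].
  apply: (IHn _ _ r y') => //; rewrite ?smaller //.
  - exact: contr_sym.
  - exact: contr_irrefl.
  - by rewrite !inE ry.
  - by rewrite !inE y'A eq_sym neq.
  - by rewrite /contr eqxx gyy' orbT eq_sym y'r.
case/forall_inPn => z; rewrite !inE -leqNgt => /and3P[zr zy zA] dz.
have [|w [Nz [wr wy wz wA]]] := contr_degree_drop gs gi rA yA ry zA zr zy _ dz.
  by apply: d3; rewrite !inE zr.
have gz b : b \in A -> g z b = [|| b == r, b == y | b == w].
  by move=> bA; move/setP/(_ b): Nz; rewrite !inE bA -orbA.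
have gzr : g z r by rewrite gz ?eqxx.
have gzy : g z y by rewrite gz ?eqxx ?orbT.
have gzw : g z w by rewrite gz ?eqxx ?orbT.
have dw3 : 2 < #|nbrs g A w| by apply: d3; rewrite !inE wr.
have zw : z != w by rewrite eq_sym.
(* Contracting [zw] will give either the minor or, by its failure, these adjacencies; they are
   exploited first. *)
suff: K4_minor g A \/ (g y w /\ (g w r \/ nbrs g A y = [set z; w; r])).
  case=> // -[gyw wrNy].
  have wC : w \in A :\: [set z; y; r] by rewrite !inE !negb_or wz wy wr.
  have [D [wD DC cD clD]] := component_exists gs wC.
  have DA : D \subset A by apply: subset_trans DC (subsetDl _ _).
  have notD a : a \in [set z; y; r] -> a \notin D.
    by move=> aS; apply/negP => /(subsetP DC); rewrite inE aS.
  have [zD yD rD] : [/\ z \notin D, y \notin D & r \notin D].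
    by split; apply: notD; rewrite !inE eqxx ?orbT.
  have [/exists_inP[a aD gar]|noDr] := boolP [exists a in D, g a r].
    apply: (@K4_build _ _ [set z] [set y] [set r] D gs).
    - move=> B; rewrite !inE => /or4P[]/eqP->; rewrite ?sub1set -?card_gt0 ?cards1.
      + by split=> //; apply: conn1.
      + by split=> //; apply: conn1.
      + by split=> //; apply: conn1.
      + by split=> //; apply/card_gt0P; exists w.
    - rewrite /= !disjoints1 !inE zr zy (eq_sym y) ry zD yD rD //.
    - by exists z, y; rewrite !inE !eqxx.
    - by exists z, r; rewrite !inE !eqxx.
    - by exists z, w; rewrite !inE !eqxx.
    - by exists y, r; rewrite !inE !eqxx gs.
    - by exists y, w; rewrite !inE !eqxx.
    - by exists r, a; rewrite !inE !eqxx gs.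
  have noDr' a : a \in D -> ~~ g a r.
    by move=> aD; apply: contra noDr => ?; apply/exists_inP; exists a.
  case: wrNy => [gwr|Ny]; first by have := noDr' _ wD; rewrite gwr.
  have gy b : b \in A -> g y b = [|| b == z, b == w | b == r].
    by move=> bA; move/setP/(_ b): Ny; rewrite !inE bA -orbA.
  apply: (@K4_minor_sub g _ D) => //.
  have [w' w'N /norP[w'z w'y]] : exists2 b, b \in nbrs g A w & ~~ ((b == z) || (b == y)).
    have /card_gt0P[b] : 0 < #|nbrs g A w :\: [set z; y]|.
      rewrite cardsD subn_gt0 (leq_ltn_trans (subset_leq_card (subsetIr _ _))) //.
      by rewrite cards2 zy.
    by rewrite in_setD in_set2 => /andP[? ?]; exists b.
  move: w'N; rewrite inE => /andP[w'A gww'].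
  have w'D : w' \in D.
    apply: (clD _ _ wD _ gww'); rewrite !inE w'A !negb_or w'z w'y andbT.
    by apply: contraNneq (noDr' _ wD) => <-.
  apply: (IHn _ _ w w') => //.
    apply: leq_trans An; apply: proper_card; apply/properP; split=> //.
    by exists z.
  (* No edge at [v] leaves [D] within [A]: [z] and [y] see only [w] in [D], and [r] sees nothing
     there. So [v] keeps its degree. *)
  move=> v; rewrite !inE => /andP[vw vD].
  have vA := subsetP DA _ vD.
  have nvD a : a \notin D -> v != a by apply: contraNneq => <-.
  apply: leq_trans (d3 v _) _; first by rewrite !inE vA nvD.
  apply: subset_leq_card; apply/subsetP => b; rewrite !inE => /andP[bA gvb].
  rewrite gvb andbT; apply: (clD _ _ vD _ gvb); rewrite !inE bA andbT !negb_or.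
  apply/andP; split; last by apply: contraNneq (noDr' _ vD) => <-.
  apply/andP; split; apply: contraTneq gvb => ->; rewrite gs.
    by rewrite gz // !negb_or vw !nvD.
  by rewrite gy // !negb_or vw !nvD.
case: (boolP [forall v in A :\ w :\ r, 2 < #|nbrs (contr g z w) (A :\ w) v|]).
  move/forall_inP => d3'; left; apply: (K4_contr gs wA gzw).
  apply: (IHn _ _ r y) => //; rewrite ?smaller //.
  - exact: contr_sym.
  - exact: contr_irrefl.
  - by rewrite !inE eq_sym wr.
  - by rewrite !inE eq_sym wy.
  - by rewrite /contr ry gry.
case/forall_inPn => v; rewrite !inE -leqNgt => /and3P[vr vw vA] dv; right.
(* If the merged vertex [z] itself drops, it retains just [r] and [y], so [w], having at least three
   neighbours, has exactly [z], [r] and [y]. *)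
have [evz|vz] := eqVneq v z.
  have ryN : [set r; y] \subset nbrs (contr g z w) (A :\ w) z.
    apply/subsetP => b /set2P[]->; rewrite !inE /contr ?(gs z).
      by rewrite eq_sym wr rA zr (gs r) gzr.
    by rewrite eq_sym wy yA zy (gs y) gzy.
  have eN : nbrs (contr g z w) (A :\ w) z = [set r; y].
    by apply/esym/eqP; rewrite eqEcard ryN cards2 ry; move: dv; rewrite evz.
  have sN : nbrs g A w \subset z |: [set r; y].
    apply/subsetP => b; rewrite inE => /andP[bA gwb].
    rewrite in_setU1 -eN !inE bA /contr eqxx gwb /=.
    rewrite (eq_sym b w) (neq _ _ gwb) (eq_sym z).
    by case: (b == z) => //=; rewrite !orbT.
  have eNw : nbrs g A w = z |: [set r; y].
    apply/eqP; rewrite eqEcard sN; apply: leq_trans dw3.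
    by rewrite cardsU1 cards2 !inE ry negb_or zr zy.
  have gw b : b \in A -> g w b = [|| b == z, b == r | b == y].
    by move=> bA; move/setP/(_ b): eNw; rewrite !inE bA.
  by rewrite gs gw ?eqxx ?orbT //; split=> //; left; rewrite gw // eqxx orbT.
(* Otherwise [v] is a neighbour of [z] other than [r] and [w], hence [y]; its third neighbour is
   then [r]. *)
have [|x [Nv [xz xw xv xA]]] := contr_degree_drop gs gi zA wA zw vA vz vw _ dv.
  by apply: d3; rewrite !inE vr.
have gv b : b \in A -> g v b = [|| b == z, b == w | b == x].
  by move=> bA; move/setP/(_ b): Nv; rewrite !inE bA -orbA.
have evy : v = y.
  have : g z v by rewrite gs gv ?eqxx.
  by rewrite gz // (negPf vr) (negPf vw) orbF => /eqP.
have gyw : g y w by rewrite -evy gv ?eqxx ?orbT.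
have exr : x = r.
  have : g v r by rewrite evy gs.
  by rewrite gv // eq_sym (negPf zr) eq_sym (negPf wr) /= => /eqP.
by split=> //; right; rewrite -evy -exr.
Qed.

Lemma K4_free_low_degree g A : symmetric g -> irreflexive g ->
  A != set0 -> ~ K4_minor g A -> exists2 v, v \in A & #|nbrs g A v| <= 2.
Proof.
move=> gs gi /set0Pn[r rA] noK4.
case: (boolP [exists v in A, #|nbrs g A v| <= 2]) => [/exists_inP//|no].
have d3 v : v \in A -> 2 < #|nbrs g A v|.
  by move=> vA; rewrite ltnNge; apply: contra no => ?; apply/exists_inP; exists v.
have /card_gt0P[y] : 0 < #|nbrs g A r| by apply: leq_trans (d3 _ rA).
rewrite inE => /andP[yA gry]; case: noK4.
by apply: (rooted_dirac gs gi rA yA gry) => v /setD1P[_ /d3].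
Qed.

(** * Chordal completion by vertex elimination *)

(* Eliminating vertices by decreasing [rho] is a perfect elimination of the
   chordal supergraph [h] of [g], all of whose cliques have at most three
   vertices. *)
Definition chordal_completion g A (h : rel T) (rho : T -> nat) : Prop :=
  [/\ symmetric h, {in A &, subrel g h},
      {in A &, forall x y, h x y -> rho x != rho y},
      {in A, forall v, #|[set x in A | h v x & rho x < rho v]| <= 2}
    & {in A & &, forall v x y, h v x -> h v y -> rho x < rho v -> rho y < rho v ->
         x != y -> h x y}].

Lemma K4_free_chordal_completion g A : symmetric g -> irreflexive g ->
  ~ K4_minor g A -> exists h rho, chordal_completion g A h rho.
Proof.
move=> gs gi noK4.
(* The bound on [rho] makes [#|A :\ v|] a rank above all others, free for the vertex [v] that is put
   back. *)
suff [h [rho [hrho _]]] : exists h rho,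
    chordal_completion g A h rho /\ {in A, forall x, rho x < #|A|}.
  by exists h, rho.
have [n] := ubnP #|A|; elim: n => // n IHn in g A gs gi noK4 *; rewrite ltnS => An.
have [->|A0] := eqVneq A set0.
  by exists g, (fun => 0); split; [split=> // |] => v; rewrite inE.
have [v vA dv] := K4_free_low_degree gs gi A0 noK4.
pose g' a b := g a b || [&& a != b, g v a & g v b].
have g's : symmetric g'.
  by move=> a b; rewrite /g' gs eq_sym; congr (_ || (_ && _)); rewrite andbC.
have g'i : irreflexive g' by move=> a; rewrite /g' gi eqxx.
have cA : #|A| = #|A :\ v|.+1 by rewrite (cardsD1 v) vA.
have noK4' : ~ K4_minor g' (A :\ v).
  move=> K4; apply: noK4.
  (* An isolated [v] adds no edge; otherwise every edge added by [g'] also arises by contracting [v]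
     onto a neighbour [x]. *)
  have [N0|/set0Pn[x xN]] := eqVneq (nbrs g A v) set0.
    apply: K4_minor_sub K4 => [|a b]; first exact: subsetDl.
    rewrite !inE => /andP[_ aA] _ /orP[//|/and3P[_ gva _]].
    by move/setP/(_ a): N0; rewrite !inE aA gva.
  have := xN; rewrite inE => /andP[xA gvx].
  apply: (@K4_contr _ _ x v) => //; first by rewrite gs.
  apply: K4_minor_sub K4 => // a b; rewrite !inE => /andP[_ aA] /andP[_ bA].
  rewrite /g' /contr => /orP[gab|/and3P[ab gva gvb]].
    by rewrite gab andbT; apply: contraTneq gab => ->; rewrite gi.
  rewrite ab (gs a v) gva gvb !andbT /=; apply/orP; right.
  (* One of [a], [b] is [x], since otherwise [v] would have the three neighbours [x], [a], [b]. *)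
  apply: contraLR dv; rewrite negb_or -ltnNge => /andP[ax bx].
  suff <-: #|x |: [set a; b]| = 3.
    apply: subset_leq_card; apply/subsetP => c.
    by rewrite !inE => /or3P[]/eqP->; apply/andP.
  by rewrite cardsU1 cards2 !inE ab (eq_sym x) (negPf ax) eq_sym (negPf bx).
have [|h [rho [[hs gh rhon lo cl] rhoA]]] := IHn g' (A :\ v) g's g'i noK4'.
  by rewrite -cA.
pose h1 a b := if a == v then g v b else if b == v then g v a else h a b.
pose rho1 a := if a == v then #|A :\ v| else rho a.
have rho1lt a : a \in A -> a != v -> rho1 a < rho1 v.
  by move=> aA av; rewrite /rho1 eqxx (negPf av); apply: rhoA; rewrite !inE av.
have inA' a : a \in A -> a != v -> a \in A :\ v by move=> aA av; rewrite !inE av.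
have below a b : a \in A -> rho1 a < rho1 b -> b \in A -> a != v.
  move=> aA + bA; apply: contraTneq => ->; rewrite -leqNgt.
  by have [->|bv] := eqVneq b v; rewrite // ltnW ?rho1lt.
exists h1, rho1; split; last first.
  move=> a aA; rewrite cA ltnS; have [->|av] := eqVneq a v; first by rewrite /rho1 eqxx.
  by have := rho1lt a aA av; rewrite /rho1 eqxx (negPf av) => /ltnW.
split.
- move=> a b; rewrite /h1; have [->|av] := eqVneq a v; have [eb|bv] := eqVneq b v; rewrite ?eb //; exact: hs.
- move=> a b aA bA gab; rewrite /h1.
  have [ea|av] := eqVneq a v; first by rewrite -ea.
  have [eb|bv] := eqVneq b v; first by rewrite -eb gs.
  by apply: gh; rewrite ?inA' // /g' gab.
- move=> a b aA bA; have [->|av] := eqVneq a v; have [->|bv] := eqVneq b v.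
  + by rewrite /h1 eqxx gi.
  + by rewrite eq_sym ltn_eqF ?rho1lt.
  + by rewrite ltn_eqF ?rho1lt.
  + by rewrite /h1 /rho1 (negPf av) (negPf bv); apply: rhon; apply: inA'.
- move=> w wA; have [->|wv] := eqVneq w v.
    apply: leq_trans dv; apply: subset_leq_card; apply/subsetP => b.
    by rewrite !inE /h1 eqxx => /and3P[-> ->].
  apply: leq_trans (lo w (inA' _ wA wv)); apply: subset_leq_card.
  apply/subsetP => b; rewrite !inE => /and3P[bA hwb lt].
  have bv := below _ _ bA lt wA.
  by move: hwb lt; rewrite /h1 /rho1 (negPf wv) (negPf bv) bA => -> ->.
- move=> w a b wA aA bA hwa hwb lta ltb ab.
  have av := below _ _ aA lta wA; have bv := below _ _ bA ltb wA.
  rewrite /h1 (negPf av) (negPf bv).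
  have [ew|wv] := eqVneq w v.
    move: hwa hwb; rewrite ew /h1 eqxx => gva gvb.
    by apply: gh; rewrite ?inA' // /g' ab gva gvb orbT.
  move: hwa hwb lta ltb; rewrite /h1 /rho1 (negPf wv) (negPf av) (negPf bv).
  by move=> *; apply: (cl w) => //; apply: inA'.
Qed.

(** No edge inside [B] leaves the set of vertices reachable from [u], so that set is not a proper
    subset. *)
Lemma conn_connected_set g B : conn g B -> connected_set g B.
Proof.
move=> cB u v uB vB; set e := [rel x y | _].
pose D := [set x in B | connect e u x].
have [eDB|nDB] := eqVneq D B.
  by move: vB; rewrite -eDB inE => /andP[].
have pD : D \proper B.
  by rewrite properEneq nDB; apply/subsetP => x; rewrite inE => /andP[].
have D0 : D != set0 by apply/set0Pn; exists u; rewrite inE uB connect0.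
have [a [b []]] := cB D pD D0; rewrite !inE => /andP[aB ua] /andP[+ bB] gab.
by rewrite bB (connect_trans ua) //; apply: connect1; rewrite /= aB bB.
Qed.

End Minors.

(** * Greedy colouring of a conflict relation *)

(** An element of largest key is coloured last: its conflicts in [F] have no larger key, so fewer
    than [N] colours are forbidden. Ties are harmless because keys are compared by [<=]. *)
Lemma greedy_colouring (E : finType) (C : rel E) (key : E -> nat) (N : nat) :
  symmetric C ->
  (forall e, #|[set f | [&& f != e, key f <= key e & C e f]]| < N) ->
  exists c : E -> nat,
    (forall e, c e < N) /\ forall e f, e != f -> C e f -> c e != c f.
Proof.
move=> Cs few.
suff [c [cN cP]] : exists c : E -> nat, (forall e, c e < N) /\
    {in [set: E] &, forall e f, e != f -> C e f -> c e != c f}.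
  by exists c; split=> // e f; apply: cP.
have [n] := ubnP #|[set: E]|; move: [set: E] => F.
elim: n F => // n IHn F; rewrite ltnS => Fn.
have [->|/set0Pn[e0 e0F]] := eqVneq F set0.
  exists (fun => 0); split=> [e|e]; last by rewrite inE.
  exact: leq_ltn_trans (few e).
case: (@arg_maxnP _ e0 [in F] key e0F) => e /= eF emax.
have [|c [cN cP]] := IHn (F :\ e); first by rewrite (cardsD1 e) eF in Fn.
pose S := [set f | [&& f != e, key f <= key e & C e f]].
have [i iN iS] : exists2 i, i < N & i \notin [seq c f | f in S].
  have /allPn[i iN iS] : ~~ all (mem [seq c f | f in S]) (iota 0 N).
    apply/negP => /allP /(uniq_leq_size (iota_uniq _ _)).
    by rewrite size_iota size_map -cardE leqNgt few.
  by exists i; rewrite // mem_iota in iN.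
have new f : f \in F -> f != e -> C e f -> i != c f.
  move=> fF fe Cef; apply: contraNneq iS => ->; apply: image_f.
  by rewrite inE fe Cef andbT; apply: emax.
exists (fun f => if f == e then i else c f); split=> [f|f f' fF f'F ff' Cff'].
  by case: eqP.
have [fe|fe] := eqVneq f e; have [f'e|f'e] := eqVneq f' e.
- by rewrite fe f'e eqxx in ff'.
- by apply: new => //; rewrite -fe.
- by rewrite eq_sym; apply: new => //; rewrite -f'e Cs.
- by apply: cP => //; rewrite !inE ?fe ?f'e.
Qed.

(** * Strong edge-colourings from colouring functions *)

Section Multigraphs.
Variable G : multigraph.

Lemma joined_sym : symmetric (@joined_edges G).
Proof.
move=> e f; apply/exists_inP/exists_inP => -[u ue /exists_inP[v vf uv]];
  by exists v => //; apply/exists_inP; exists u; rewrite // adj_sym.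
Qed.

(** The edge [e] itself joins its other endpoint to the shared one. Hence [joined_edges] alone
    serves as the conflict relation. *)
Lemma incident_joined (e f : edge G) : incident_edges e f -> joined_edges e f.
Proof.
case/pred0Pn => u /andP[/= ue uf].
have /cards1P[v ev] : #|ends e :\ u| == 1.
  by have /eqP := card_ends e; rewrite (cardsD1 u) ue add1n eqSS.
have : v \in ends e :\ u by rewrite ev set11.
case/setD1P => _ ve; apply/exists_inP; exists v => //.
apply/exists_inP; exists u => //; apply/existsP; exists e.
by rewrite -(setD1K ue) ev setUC.
Qed.

(** The nonempty colour classes form the partition; there are at most [N] of them, and the index is
    minimal. *)
Lemma strong_chromatic_index_le (c : edge G -> nat) (N : nat) :
  (forall e, c e < N) ->
  (forall e f, e != f -> joined_edges e f -> c e != c f) ->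
  strong_chromatic_index G <= N.
Proof.
move=> cN cP; pose P := preim_partition c [set: edge G].
have PN : #|P| <= N.
  have /subset_leq_card/leq_trans :
      P \subset [set [set e | c e == i] | i : 'I_N].
    apply/subsetP => _ /imsetP[e _ ->]; apply/imsetP; exists (Ordinal (cN e)) => //.
    by apply/setP => f; rewrite !inE eq_sym.
  by apply; rewrite (leq_trans (leq_imset_card _ _)) // cardT size_enum_ord.
apply: leq_trans PN; rewrite /strong_chromatic_index.
case: ex_minnP => m _; apply; apply/existsP; exists P; rewrite eqxx andbT.
apply/andP; split; first exact: preim_partitionP.
apply/forall_inP => _ /imsetP[e _ ->].
apply/forall_inP => f; rewrite !inE => /eqP ef.
apply/forall_inP => f'; rewrite !inE => /eqP ef'; apply/implyP => ff'.
have nj : ~~ joined_edges f f'.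
  by apply/negP => /(cP _ _ ff'); rewrite -ef -ef' eqxx.
by rewrite nj andbT; apply: contra nj; apply: incident_joined.
Qed.

End Multigraphs.

(** * Colouring edges along the elimination order *)

Theorem theorem1p6 (G : multigraph) (Delta : nat)
  (hfree : complete_minor_free 4 G) (hdeg : max_degree G = Delta) :
  strong_chromatic_index G <= 3 * Delta.
Proof.
have noK4 : ~ K4_minor (@adj G) [set: vertex G].
  case=> B [B1 B2]; apply: hfree; exists B; split=> [i|i j /B2[]//|i j /B2[_ []]//].
  - by have [_ B0 cB] := B1 i; split=> //; apply: conn_connected_set.
  - by move=> a [b ab]; exists a, b.
have [h [rho [hs gh rhon lo cl]]] :=
  K4_free_chordal_completion (@adj_sym G) (@adj_irrefl G) noK4.
have {}gh a b : adj a b -> h a b by apply: gh; rewrite inE.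
have {}rhon a b : h a b -> rho a != rho b by apply: rhon; rewrite inE.
have {}lo v : #|[set x | h v x & rho x < rho v]| <= 2.
  by have := lo v (in_setT v); congr (_ <= _); apply: eq_card => x; rewrite !inE.
have {}cl v a b : h v a -> h v b -> rho a < rho v -> rho b < rho v ->
    a != b -> h a b by apply: cl; rewrite inE.
have split_edge (e : edge G) :
    exists p : vertex G * vertex G, ends e = [set p.1; p.2] /\ rho p.1 < rho p.2.
  have /cards2P[a [b [_ eab]]] : #|ends e| == 2 by rewrite card_ends.
  have /gh /rhon : adj a b by apply/existsP; exists e; rewrite eab.
  rewrite neq_ltn => /orP[lt|lt]; first by exists (a, b).
  by exists (b, a); rewrite eab setUC.
have [lh lhP] := fin_all_exists split_edge.
pose near u := u |: [set x | h u x & rho x < rho u].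
have key_claim e f : rho (lh f).1 <= rho (lh e).1 -> joined_edges e f ->
    exists2 x, x \in near (lh e).1 & x \in ends f.
  have [ee uw] := lhP e; have [ef pq] := lhP f.
  have /gh huw : adj (lh e).1 (lh e).2 by apply/existsP; exists e; rewrite ee.
  have /gh hpq : adj (lh f).1 (lh f).2 by apply/existsP; exists f; rewrite ef.
  move: ee uw ef pq huw hpq.
  case: (lh e) => u w; case: (lh f) => p q /= ee uw ef pq huw hpq pu.
  have viap : p = u \/ h u p -> exists2 x, x \in near u & x \in ends f.
    move=> pu'; exists p; last by rewrite ef set21.
    rewrite !inE; case: pu' => [->|hup]; first by rewrite eqxx.
    by rewrite hup ltn_neqAle pu (eq_sym (rho p)) rhon ?orbT.
  (* Two earlier neighbours of one vertex [a] are equal or adjacent in [h]; this is used with [a]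
     the upper endpoint [q] or [w]. *)
  have below a : h a p -> h a u -> rho u < rho a -> p = u \/ h u p.
    move=> hap hau ua; have [->|pu'] := eqVneq p u; [by left | right].
    by apply: (cl a) => //; [apply: leq_ltn_trans ua | rewrite eq_sym].
  have huq : h u q -> exists2 x, x \in near u & x \in ends f.
    move=> huq; have := rhon _ _ huq; rewrite neq_ltn => /orP[ltuq|ltqu].
      by apply: viap; apply: (below q); rewrite // hs.
    by exists q; rewrite ?ef ?set22 // !inE huq ltqu orbT.
  have hwp : h w p -> exists2 x, x \in near u & x \in ends f.
    by move=> hwp; apply: viap; apply: (below w); rewrite // hs.
  case/exists_inP => a + /exists_inP[b + /gh].
  rewrite ee ef => /set2P[]-> /set2P[]-> => [hup||//|hwq]; rewrite -?ef //.
    by apply: viap; right.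
  (* A join of the upper endpoints reduces to one between [w] and [p] if [q] is the higher, and to
     [u = q] or one between [u] and [q] if [w] is. *)
  have := rhon _ _ hwq; rewrite neq_ltn => /orP[ltwq|ltqw].
    apply: hwp; apply: (cl q) => //; first by rewrite hs.
      by rewrite hs.
    by apply: contraTneq pu => <-; rewrite -ltnNge.
  have [equ|uq] := eqVneq u q.
    by exists q; rewrite ?ef ?set22 // equ setU11.
  by apply: huq; apply: (cl w) => //; rewrite hs.
have few e : #|[set f | [&& f != e, rho (lh f).1 <= rho (lh e).1
                          & joined_edges e f]]| < 3 * Delta.
  set S := [set f | _]; set u := (lh e).1.
  have [ee _] := lhP e.
  have eS : e \notin S by rewrite inE eqxx.
  (* Since [e] also meets [near u] but is not in [S], counting it gives the strict inequality that
     leaves a colour free. *)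
  have -> : (#|S| < 3 * Delta) = (#|e |: S| <= 3 * Delta) by rewrite cardsU1 eS.
  have sub : e |: S \subset \bigcup_(x in near u) [set f : edge G | x \in ends f].
    apply/subsetP => f /setU1P[->|].
      by apply/bigcupP; exists u; rewrite ?setU11 // inE ee set21.
    rewrite inE => /and3P[_ le /(key_claim _ _ le)[x xn xf]].
    by apply/bigcupP; exists x; rewrite // inE.
  apply: leq_trans (subset_leq_card sub) _.
  have ub (X : {set vertex G}) :
      #|\bigcup_(x in X) [set f : edge G | x \in ends f]| <= #|X| * Delta.
    apply: leq_trans (_ : \sum_(x in X) degree x <= _).
      rewrite /degree; elim/big_rec2: _ => [|x m Y _ le]; first by rewrite cards0.
      by rewrite (leq_trans (leq_card_setU _ _)) // leq_add2l.
    rewrite -sum_nat_const; apply: leq_sum => x _; rewrite -hdeg.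
    exact: (leq_bigmax x).
  apply: leq_trans (ub _) _; rewrite leq_mul2r; apply/orP; right.
  by rewrite cardsU1 -[3]/(1 + 2) leq_add ?leq_b1.
have [c [cN cP]] := greedy_colouring (@joined_sym G) few.
exact: strong_chromatic_index_le cN cP.
Qed.
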